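(* Let $n\ge 0$ be an integer. Then for all integers $i,j$ with $0\le i,j\le n$, \[\int_{-1}^1 P_i^*(x)\,P_j^*(x)\,\frac{1}{K_n(x)}\,\frac{1}{\pi}\,\frac{1}{\sqrt{1-x^2}}\,dx=\delta_{ij},\] where $P_k^*$ denotes the orthonormalized Legendre polynomial of degree $k$ on $[-1,1]$, $K_n(x)=\frac{1}{n+1}\sum_{k=0}^n (P_k^*(x))^2$, and $\delta_{ij}$ is the Kronecker delta.
   Context: $P_k(x)$ denotes the classical Legendre polynomial of degree $k$ (normalized by $P_k(1)=1$, orthogonal on $[-1,1]$ with respect to Lebesgue measure $dx$). Its orthonormalized version is $P_k^*(x):=\frac{\sqrt{2k+1}}{\sqrt 2}P_k(x)$, so that $\int_{-1}^1 P_i^*(x)P_j^*(x)\,dx=\delta_{i,j}$ for all $i,j\ge 0$. The normalized reciprocal Christoffel function is $K_n(x):=\frac{1}{n+1}\sum_{k=0}^n (P_k^*(x))^2$, which is positive for real $x$. *)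

(* Defs.v *)
From HB Require Import structures.
From mathcomp Require Import all_boot all_order all_algebra.
From mathcomp Require Import all_classical all_reals all_analysis.

Set Implicit Arguments.
Unset Strict Implicit.
Unset Printing Implicit Defensive.

Import Order.TTheory GRing.Theory Num.Theory.
Import numFieldNormedType.Exports.

Local Open Scope classical_set_scope.
Local Open Scope ring_scope.

(* These three conditions determine the classical Legendre polynomials
   uniquely; recall that [size p] is the degree of [p] plus one. *)
Definition is_legendre (R : realType) (P : nat -> {poly R}) : Prop :=
  [/\ forall k, size (P k) = k.+1,
      forall k, (P k).[1] = 1
    & forall i j, i <> j ->
        (\int[@lebesgue_measure R]_(x in `[(-1)%R, 1%R])
          ((P i).[x] * (P j).[x])%:E = 0)%E].

Definition legendre_star (R : realType) (P : nat -> {poly R}) (k : nat)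
    (x : R) : R :=
  Num.sqrt (2 * k + 1)%:R / Num.sqrt 2 * (P k).[x].

Definition christoffel (R : realType) (P : nat -> {poly R}) (n : nat)
    (x : R) : R :=
  n.+1%:R^-1 * \sum_(0 <= k < n.+1) legendre_star P k x ^+ 2.

(* Main.v *)
Require Import Defs.
From HB Require Import structures.
From mathcomp Require Import all_boot all_order all_algebra.
From mathcomp Require Import all_classical all_reals all_analysis.
From mathcomp Require Import measurable_realfun.
From mathcomp Require Import ring lra complex.

Set Implicit Arguments.
Unset Strict Implicit.
Unset Printing Implicit Defensive.

Import Order.TTheory GRing.Theory Num.Theory.
Import numFieldNormedType.Exports.
Import ComplexField.Normc.

Local Open Scope classical_set_scope.
Local Open Scope ring_scope.

(** Write [L_n] for the Legendre polynomials and [D_n] for the sum of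
    [(2k+1) L_k^2] over [k <= n], so that [K_n = D_n / (2(n+1))].  After
    normalization the claim is that the functional
    [M p = int p / D_n dx / (pi sqrt(1-x^2))] makes [L_0, ..., L_n] orthogonal
    with [M (L_i^2) = 1 / ((n+1)(2i+1))].

    The reason is of Bernstein-Szego type.  On the upper half circle put
    [z = x + i sqrt(1-x^2)] and
      [F_n = L_n - i sqrt(1-x^2) L_n' / (n+1)].
    The two first-order recursions between [L_n, L_n'] and [L_{n+1}, L_{n+1}']
    say exactly that
      [F_{n+1} = ((2n+3) zbar F_n + z Fbar_n) / (2n+4)]
    ([leg_phaseS]), a recursion of Szego type, and they give
    [|F_n|^2 = D_n / (n+1)^2] ([sum_leg_sqr]), [L_n = Re F_n] and
    [L_{n+1} = Re (zbar F_n)].  Hence, up to the factor [(n+1)^2],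
    [L_n / D_n] is [Re (1 / F_n)] and [L_{n+1} / D_n] is [Re (z / F_n)].

    By the recursion, [z^n F_n] is a real polynomial in [z], and it can be
    inverted approximately, uniformly on the circle, by real polynomials in [z]:
    in [(2n+3) z^n F_n + z^(n+2) Fbar_n] the second term has modulus at most a
    third of that of the first one, so a Neumann series passes from [n] to
    [n+1] ([szego_approx_inverse]).  Therefore [L_n / D_n] and [L_{n+1} / D_n]
    are uniform limits of combinations of the Chebyshev polynomials
    [T_m = Re z^m] with [m >= n], and these are orthogonal, for the arcsine
    weight, to all polynomials of degree less than [n].  Thus [M] annihilates
    [L_n p] and [L_{n+1} p] when [deg p < n] ([christoffel_int_leg_low]).

    These two facts suffice: run downwards, the three-term recurrence makes
    [L_0, ..., L_n] orthogonal for [M] and gives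
    [M (L_i^2) = M 1 / (2i+1)] ([leg_orthogonality]).  Finally
    [1 = M D_n = (n+1) M 1] because the arcsine weight has mass one.

    The same criterion [leg_orthogonality], applied to the Lebesgue integral,
    yields the norms that identify the given family with the explicit [L_n]
    ([is_legendre_unique]). *)

(** * Legendre polynomials and their recursions *)

Section LegendrePolynomials.
Variable R : realFieldType.

(** The definition by a first-order recursion, in place of the three-term one,
    makes the pair [(L_n, L_n')] the natural object: it is this pair that
    becomes a complex number on the circle below. *)
Fixpoint leg (n : nat) : {poly R} :=
  if n is m.+1 then
    'X * leg m + m.+1%:R^-1 *: (('X ^+ 2 - 1) * (leg m)^`())
  else 1.

Lemma leg0 : leg 0 = 1. Proof. by []. Qed.

Lemma legE m : leg m.+1
  = 'X * leg m + m.+1%:R^-1 *: (('X ^+ 2 - 1) * (leg m)^`()).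
Proof. by []. Qed.

Arguments leg : simpl never.

Lemma leg1 : leg 1 = 'X.
Proof. by rewrite legE leg0 derivC mulr0 scaler0 addr0 mulr1. Qed.

Lemma natrP_neq0 n : (n.+1%:R : {poly R}) != 0.
Proof. by rewrite -polyC_natr polyC_eq0 pnatr_eq0. Qed.

Lemma legS n : n.+1%:R * leg n.+1
  = n.+1%:R * ('X * leg n) + ('X ^+ 2 - 1) * (leg n)^`().
Proof.
rewrite legE mulrDr; congr (_ + _).
by rewrite -polyC_natr mul_polyC scalerA mulfV ?pnatr_eq0// scale1r.
Qed.

(** The two identities have to be proved together: Legendre's equation at [n]
    turns the derivative of the recursion into the formula for [L_{n+1}'], and
    that formula gives Legendre's equation at [n+1]. *)
Lemma deriv_legS_ode n :
  (leg n.+1)^`() = n.+1%:R * leg n + 'X * (leg n)^`() /\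
  ('X ^+ 2 - 1) * (leg n)^`()^`() + 2 * 'X * (leg n)^`()
    = (n * n.+1)%:R * leg n.
Proof.
have deriv_of_ode m : ('X ^+ 2 - 1) * (leg m)^`()^`() + 2 * 'X * (leg m)^`()
    = (m * m.+1)%:R * leg m ->
    (leg m.+1)^`() = m.+1%:R * leg m + 'X * (leg m)^`().
  move=> ode; apply: (mulfI (natrP_neq0 m)).
  have := congr1 (@deriv R) (legS m); move: (leg m.+1) => L1.
  rewrite derivD !derivM derivB derivXn derivX -polyC_natr !derivC.
  rewrite !mul0r !add0r polyC_natr subr0 /= => ->.
  move/eqP: ode; rewrite -subr_eq0 => /eqP ode.
  rewrite -[RHS]addr0 -ode natrM; ring.
elim: n => [|n [dS ode]].
  have ode0 : ('X ^+ 2 - 1) * (leg 0)^`()^`() + 2 * 'X * (leg 0)^`()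
    = (0 * 1)%:R * leg 0 by rewrite leg0 !derivC mul0n; ring.
  by split=> //; exact: deriv_of_ode.
suff odeS : ('X ^+ 2 - 1) * (leg n.+1)^`()^`() + 2 * 'X * (leg n.+1)^`()
    = (n.+1 * n.+2)%:R * leg n.+1 by split=> //; exact: deriv_of_ode.
rewrite dS derivD derivM derivM derivX -polyC_natr derivC polyC_natr.
have -> : (n.+1 * n.+2)%:R * leg n.+1 = n.+2%:R * (n.+1%:R * leg n.+1).
  by rewrite natrM; ring.
move/eqP: ode; rewrite -subr_eq0 => /eqP ode.
rewrite legS -[RHS]addr0 -[in RHS](mulr0 'X) -[in RHS]ode natrM; ring.
Qed.

Lemma deriv_legS n : (leg n.+1)^`() = n.+1%:R * leg n + 'X * (leg n)^`().
Proof. by have [] := deriv_legS_ode n. Qed.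

Lemma leg_ode n : ('X ^+ 2 - 1) * (leg n)^`()^`() + 2 * 'X * (leg n)^`()
  = (n * n.+1)%:R * leg n.
Proof. by have [] := deriv_legS_ode n. Qed.

Lemma leg_three_term n : (2 * n + 3)%:R * ('X * leg n.+1)
  = n.+2%:R * leg n.+2 + n.+1%:R * leg n.
Proof.
rewrite legS deriv_legS; move/eqP: (legS n).
rewrite -subr_eq0 => /eqP; move: (leg n.+1) => L1 h.
rewrite -[RHS]addr0 -[in RHS](mulr0 'X) -[in RHS]h natrD natrM; ring.
Qed.

Lemma leg_horner1 n : (leg n).[1] = 1.
Proof.
elim: n => [|n ih]; first by rewrite leg0 hornerC.
rewrite legE hornerD hornerZ !hornerM hornerX ih hornerD hornerN hornerXn hornerC.
by rewrite expr1n subrr mul0r mulr0 mulr1 addr0.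
Qed.

(** The Christoffel-Darboux formula on the diagonal, in a form that exhibits the
    sum as [(n+1)^2] times the squared modulus of [F_n].  The increment from [n]
    to [n+1] is a difference of two squares which the recursion kills. *)
Lemma sum_leg_sqr n : \sum_(0 <= k < n.+1) (2 * k + 1)%:R * leg k ^+ 2
  = n.+1%:R ^+ 2 * leg n ^+ 2 + (1 - 'X^2) * (leg n)^`() ^+ 2.
Proof.
elim: n => [|n ih]; first by rewrite big_nat1 leg0 derivC; ring.
rewrite big_nat_recr //= ih deriv_legS; move/eqP: (legS n).
rewrite -subr_eq0 => /eqP; move: (leg n.+1) => L1 h.
(* The increment equals minus the recursion, in the form [h], times its
   conjugate expression. *)
rewrite -[LHS]addr0 -[in LHS](mulr0 (n.+1%:R * ('X * leg n + L1)
  - (1 - 'X^2) * (leg n)^`())) -[in LHS]h natrD natrM; ring.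
Qed.

Lemma size_leg n : size (leg n) = n.+1.
Proof.
have hs : forall m, (size (leg m) <= m.+1)%N.
  elim=> [|m ih]; first by rewrite leg0 size_poly1.
  rewrite legE; apply: (leq_trans (size_polyD _ _)); rewrite geq_max.
  rewrite (leq_trans (size_polyMleq _ _)) ?size_polyX//=.
  apply: (leq_trans (size_scale_leq _ _)).
  apply: (leq_trans (size_polyMleq _ _)); rewrite size_XnsubC// !addSn add0n /= !ltnS.
  by apply: (leq_trans (size_poly _ _)); case: (size _) ih.
(* The coefficient of degree n is multiplied by (2n+1)/(n+1) at each step. *)
suff h0 : 0 < (leg n)`_n.
  apply/eqP; rewrite eqn_leq hs ltnNge; apply/negP => hle.
  by move: h0; rewrite nth_default // ltxx.
elim: n => [|n ih]; first by rewrite leg0 coefC eqxx.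
rewrite legE coefD coefXM coefZ mulrBl coefB coefXnM mul1r !coef_deriv /=.
case: n ih => [|n] ih.
  by rewrite leg0 !coef1 /= mul0rn subrr mulr0 addr0.
rewrite (@nth_default _ 0 _ n.+3); last exact: leqW (hs _).
rewrite mul0rn subr0 subn2 /= ltr_pwDl // mulr_ge0 ?invr_ge0 ?ler0n //.
by rewrite mulrn_wge0 // ltW.
Qed.

End LegendrePolynomials.

Arguments leg : simpl never.

(** * Functionals for which the Legendre polynomials are orthogonal *)

Section OrthogonalFunctionals.
Variable R : realFieldType.
Implicit Types (M : {scalar {poly R}}) (p q : {poly R}).

Lemma scalar_natl M k p : M (k%:R * p) = k%:R * M p.
Proof. by rewrite -polyC_natr mul_polyC linearZ. Qed.

(** One step of the division of [p] by a basis with one element in each degree. *)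
Lemma size_sub_lead (B : nat -> {poly R}) (m : nat) p :
  (forall j, size (B j) = j.+1) -> (size p <= m.+1)%N ->
  (size (p - (p`_m / lead_coef (B m)) *: B m)%R <= m)%N.
Proof.
move=> hB hp; apply/leq_sizeP => j; rewrite leq_eqVlt => /predU1P[<-|hj].
  rewrite coefB coefZ lead_coefE hB /= divfK ?subrr //.
  have : lead_coef (B m) != 0 by rewrite lead_coef_eq0 -size_poly_eq0 hB.
  by rewrite lead_coefE hB.
by rewrite coefB coefZ [p`_j]nth_default ?(leq_trans hp) // [_`_j]nth_default ?hB // mulr0 subrr.
Qed.

Lemma scalar_eq0_basis M (B : nat -> {poly R}) q (m : nat) :
  (forall j, size (B j) = j.+1) -> (forall j, (j < m)%N -> M (q * B j) = 0) ->
  forall p, (size p <= m)%N -> M (q * p) = 0.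
Proof.
move=> hB; elim: m => [|m ih] hM p hp.
  by move: hp; rewrite leqn0 size_poly_eq0 => /eqP ->; rewrite mulr0 linear0.
set c := p`_m / lead_coef (B m).
rewrite -(subrK (c *: B m) p) mulrDr linearD /= -scalerAr [M (c *: _)]linearZ /= hM //.
rewrite ih ?mulr0 ?addr0 //; last exact: size_sub_lead.
by move=> j hj; apply: hM; exact: ltnW.
Qed.

(** The three-term recurrence expresses [L_{n-1}] through [X L_n] and [L_{n+1}],
    so orthogonality of two consecutive polynomials descends to all lower
    degrees.  The pair [(L_j, L_{j+1})] is kept together because both are used
    in the step. *)
Lemma leg_orthogonal_downward M n :
  (forall p, (size p <= n)%N -> M (leg R n * p) = 0) ->
  (forall p, (size p <= n)%N -> M (leg R n.+1 * p) = 0) ->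
  forall j, (j <= n)%N -> forall p, (size p <= j)%N ->
    M (leg R j * p) = 0 /\ M (leg R j.+1 * p) = 0.
Proof.
elim: n => [|n ih] h0 h1 j; first by rewrite leqn0 => /eqP -> p hp; split; auto.
rewrite leq_eqVlt => /predU1P[-> p hp|]; first by split; auto.
rewrite ltnS => hj; apply: ih j hj => p hp; last by apply: h0; exact: leqW.
have : n.+1%:R * M (leg R n * p) = 0.
  rewrite -scalar_natl mulrA.
  have -> : n.+1%:R * leg R n = (2 * n + 3)%:R * ('X * leg R n.+1) - n.+2%:R * leg R n.+2.
    by rewrite leg_three_term addrC addKr.
  rewrite mulrBl -!mulrA linearB /= !scalar_natl (mulrCA 'X).
  rewrite h0 ?h1 ?mulr0 ?subrr // ?(leqW hp) //.
  by rewrite (leq_trans (size_polyMleq _ _)) // size_polyX.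
by move/eqP; rewrite mulf_eq0 pnatr_eq0 /= => /eqP.
Qed.

(** A functional that annihilates [L_n p] and [L_{n+1} p] for [deg p < n] agrees
    with the Lebesgue integral on all [L_i L_j] with [i, j <= n], up to a factor.
    The norms follow by evaluating [M (X L_i L_{i+1})] in two ways, expanding
    [X L_{i+1}] or [X L_i] by the recurrence. *)
Lemma leg_orthogonality M n :
  (forall p, (size p <= n)%N -> M (leg R n * p) = 0) ->
  (forall p, (size p <= n)%N -> M (leg R n.+1 * p) = 0) ->
  forall i j, (i <= n)%N -> (j <= n)%N ->
    M (leg R i * leg R j) = (i == j)%:R * M 1 / (2 * i + 1)%:R.
Proof.
move=> h0 h1 i j hi hj; have hM := leg_orthogonal_downward h0 h1.
case: (ltngtP i j) => [ij|ji|<-]; rewrite ?mul0r.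
- by rewrite mulrC; apply: (hM j hj _ _).1; rewrite size_leg.
- by apply: (hM i hi _ _).1; rewrite size_leg.
rewrite mul1r; elim: i hi {j hj} => [|i ih] hi.
  by rewrite leg0 mulr1 muln0 add0n divr1.
have hi' := ltnW hi; have {}ih := ih hi'.
have e1 : (2 * i + 3)%:R * M ('X * leg R i.+1 * leg R i)
    = i.+1%:R * M (leg R i * leg R i).
  rewrite -scalar_natl mulrA leg_three_term mulrDl linearD /= -!mulrA.
  by rewrite !scalar_natl (hM i.+1 hi (leg R i) _).2 ?mulr0 ?add0r // size_leg.
have e2 : (2 * i + 1)%:R * M ('X * leg R i.+1 * leg R i)
    = i.+1%:R * M (leg R i.+1 * leg R i.+1).
  case: i hi hi' {ih e1} => [|i] hi hi'.
    by rewrite muln0 add0n !mul1r leg1 leg0 mulr1.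
  rewrite mulrAC -scalar_natl mulrA (_ : 2 * i.+1 + 1 = 2 * i + 3)%N.
  rewrite leg_three_term mulrDl linearD /= -!mulrA !scalar_natl.
  rewrite (mulrC (leg R i)) (hM i.+2 hi (leg R i) _).1 ?size_leg ?mulr0 ?addr0 //.
  by rewrite mulnS addnAC addnC.
apply: (mulfI (x := (i.+1%:R : R))); first by rewrite pnatr_eq0.
rewrite -e2; apply: (mulfI (x := ((2 * i + 3)%:R : R))).
  by rewrite pnatr_eq0 addn3.
rewrite mulrCA e1 ih (_ : 2 * i.+1 + 1 = 2 * i + 3)%N.
  have ? : 0 <= i%:R :> R by exact: ler0n.
  by field; rewrite !gt_eqF //=; lra.
by rewrite mulnS addnAC addnC.
Qed.
End OrthogonalFunctionals.

(** * Uniqueness of the Legendre polynomials *)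

Section LebesgueFunctional.
Variable R : realType.
Local Notation mu := (@lebesgue_measure R).
Implicit Types p q : {poly R}.

Definition poly_int (p : {poly R}) : R :=
  \int[mu]_(x in `[(-1)%R, 1%R]) p.[x].

Lemma integrable_horner p : mu.-integrable `[(-1)%R, 1%R] (EFin \o horner p).
Proof.
apply: continuous_compact_integrable; first exact: segment_compact.
by apply: continuous_subspaceT; exact: continuous_horner.
Qed.

Lemma poly_int_linear : scalar poly_int.
Proof.
move=> a p q; rewrite /poly_int.
under eq_Rintegral do rewrite hornerD hornerZ.
rewrite RintegralD ?RintegralZl//; try exact: integrable_horner.
by have := integrable_horner (a *: p); congr (integrable _ _ _);
  apply/funext => x /=; rewrite hornerZ.
Qed.

HB.instance Definition _ :=
  GRing.isLinear.Build R {poly R} R _ poly_int poly_int_linear.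

Lemma poly_int_deriv p : poly_int p^`() = p.[1] - p.[-1].
Proof.
rewrite /poly_int /Rintegral.
rewrite (@continuous_FTC2 _ _ (horner p)) //=.
- by apply: continuous_subspaceT; exact: continuous_horner.
- split.
  + by move=> x _; exact: derivable_horner.
  + by apply: cvg_at_right_filter; exact: continuous_horner.
  + by apply: cvg_at_left_filter; exact: continuous_horner.
- by move=> x _; rewrite derivE.
Qed.

Lemma poly_int1 : poly_int 1 = 2.
Proof. by rewrite -(derivX R) poly_int_deriv !hornerX; ring. Qed.

(** Legendre's equation is self-adjoint: the difference of the eigenvalues times
    [L_i L_j] is the derivative of a multiple of [X^2 - 1], which vanishes at
    both endpoints. *)
Lemma poly_int_leg_neq i j : i <> j -> poly_int (leg R i * leg R j) = 0.
Proof.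
move=> ij.
have : ((i * i.+1)%:R - (j * j.+1)%:R) * poly_int (leg R i * leg R j) = 0.
  rewrite mulrBl -!scalar_natl -linearB /=.
  rewrite (_ : _ - _ = (('X ^+ 2 - 1) * ((leg R i)^`() * leg R j
      - leg R i * (leg R j)^`()))^`()).
    by rewrite poly_int_deriv !hornerM !hornerD !hornerN !hornerXn !hornerC; ring.
  rewrite mulrA (mulrCA _ (leg R i)) -!leg_ode.
  by rewrite derivM derivB derivXn derivC derivB !(derivM (leg R _)) derivM subr0 /=; ring.
move/eqP; rewrite mulf_eq0 subr_eq0 eqr_nat => /orP[/eqP h|/eqP //].
exfalso; apply: ij.
have mono m n : (m < n)%N -> (m * m.+1 < n * n.+1)%N.
  by move=> mn; apply: ltn_mul.
by case: (ltngtP i j) => // /mono; rewrite h ltnn.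
Qed.

Lemma poly_int_leg_low n p : (size p <= n)%N -> poly_int (leg R n * p) = 0.
Proof.
apply: (scalar_eq0_basis (B := leg R)) => [j|j hj]; first exact: size_leg.
by apply: poly_int_leg_neq => nj; rewrite nj ltnn in hj.
Qed.

Lemma poly_int_leg_sqr n : poly_int (leg R n * leg R n) = 2 / (2 * n + 1)%:R.
Proof.
rewrite (@leg_orthogonality _ _ n) // ?eqxx ?mul1r /= ?poly_int1 // => p hp.
  exact: poly_int_leg_low.
by apply: poly_int_leg_low; exact: leqW.
Qed.

(** Testing [p] against the [L_m] of its own degree isolates a nonzero multiple
    of its leading coefficient, namely by the norm of [L_m] computed above. *)
Lemma poly_int_nondeg p :
  (forall q, (size q <= size p)%N -> poly_int (p * q) = 0) -> p = 0.
Proof.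
move=> hp; apply/eqP/negPn/negP => p0.
have [m hm] : exists m, size p = m.+1.
  by exists (size p).-1; rewrite prednK // lt0n size_poly_eq0.
set c := p`_m / lead_coef (leg R m).
have c0 : c != 0.
  rewrite mulf_neq0 ?invr_eq0 ?lead_coef_eq0 -?size_poly_eq0 ?size_leg //.
  by move: p0; rewrite -lead_coef_eq0 lead_coefE hm.
have hs : (size (p - c *: leg R m)%R <= m)%N.
  by apply: size_sub_lead; [exact: size_leg | rewrite hm].
clearbody c; have := hp (leg R m); rewrite size_leg hm => /(_ (leqnn _)).
rewrite -(subrK (c *: leg R m) p) mulrDl linearD /= mulrC poly_int_leg_low // add0r.
rewrite -scalerAl linearZ /= poly_int_leg_sqr => /eqP.
by rewrite !mulf_eq0 (negPf c0) invr_eq0 !pnatr_eq0 addn1.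
Qed.

Lemma is_legendre_unique (P : nat -> {poly R}) : is_legendre P -> P = leg R.
Proof.
case=> hsz h1 horth; apply/funext => n.
have horthI i j : i <> j -> poly_int (P i * P j) = 0.
  move=> /horth; rewrite /poly_int /Rintegral => h.
  by under eq_integral do rewrite hornerM; rewrite h.
have hlow q : (size q <= n)%N -> poly_int (P n * q) = 0.
  apply: (scalar_eq0_basis (B := P)) => // j hj.
  by apply: horthI => nj; rewrite nj ltnn in hj.
set c := (P n)`_n / lead_coef (leg R n).
have hs : (size (P n - c *: leg R n)%R <= n)%N.
  by apply: size_sub_lead; [exact: size_leg | rewrite hsz].
have /eqP : P n - c *: leg R n = 0.
  apply: poly_int_nondeg => q hq; have hqn := leq_trans hq hs.
  by rewrite mulrBl linearB /= hlow // -scalerAl linearZ /= poly_int_leg_low // mulr0 subr0.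
rewrite subr_eq0 => /eqP hP.
have := h1 n; rewrite hP hornerZ leg_horner1 mulr1 => ->.
by rewrite scale1r.
Qed.

End LebesgueFunctional.

(** * Polynomials with real coefficients at complex points *)

Section ComplexPreliminaries.
Local Open Scope complex_scope.
Local Notation Re := complex.Re.
Local Notation Im := complex.Im.
Variable R : realType.
Implicit Types (w : R[i]) (p q : {poly R}).

Lemma complex_eqP (u v : R[i]) : Re u = Re v -> Im u = Im v -> u = v.
Proof. by case: u v => a b [c d] /= -> ->. Qed.

Lemma ReM (u v : R[i]) : Re (u * v) = Re u * Re v - Im u * Im v.
Proof. by case: u v => a b [c d]. Qed.

Lemma ImM (u v : R[i]) : Im (u * v) = Re u * Im v + Im u * Re v.
Proof. by case: u v => a b [c d]. Qed.

Lemma ReCM (a : R) w : Re (a%:C * w) = a * Re w.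
Proof. by rewrite ReM mul0r subr0. Qed.

Lemma ImCM (a : R) w : Im (a%:C * w) = a * Im w.
Proof. by rewrite ImM mul0r addr0. Qed.

Lemma ReD (u v : R[i]) : Re (u + v) = Re u + Re v.
Proof. by case: u v => a b [c d]. Qed.

Lemma ImD (u v : R[i]) : Im (u + v) = Im u + Im v.
Proof. by case: u v => a b [c d]. Qed.

Lemma ReN (u : R[i]) : Re (- u) = - Re u. Proof. by case: u. Qed.

Lemma ReJ (u : R[i]) : Re (conjc u) = Re u. Proof. by case: u. Qed.

Lemma ImJ (u : R[i]) : Im (conjc u) = - Im u. Proof. by case: u. Qed.

Lemma ReV (u : R[i]) : Re u^-1 = Re u / (Re u ^+ 2 + Im u ^+ 2).
Proof. by case: u. Qed.

Lemma ImV (u : R[i]) : Im u^-1 = - (Im u / (Re u ^+ 2 + Im u ^+ 2)).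
Proof. by case: u. Qed.

Lemma normc_ge0 w : 0 <= normc w.
Proof. by case: w => a b; exact: sqrtr_ge0. Qed.

Lemma normc_real (a : R) : normc a%:C = `|a|.
Proof. by rewrite /normc /= expr0n addr0 sqrtr_sqr. Qed.

Lemma normc_conj w : normc (conjc w) = normc w.
Proof. by case: w => a b; rewrite /normc /= sqrrN. Qed.

Lemma normcX w n : normc (w ^+ n) = normc w ^+ n.
Proof. by elim: n => [|n ih]; rewrite ?normc1 // !exprS normcM ih. Qed.

Lemma normr_Re w : `|Re w| <= normc w.
Proof.
by case: w => a b; rewrite -sqrtr_sqr ler_sqrt ?lerDl ?sqr_ge0 // addr_ge0 ?sqr_ge0.
Qed.

Definition ceval p w : R[i] := (map_poly (real_complex R) p).[w].

Lemma cevalD p q w : ceval (p + q) w = ceval p w + ceval q w.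
Proof. by rewrite /ceval rmorphD hornerD. Qed.

Lemma cevalN p w : ceval (- p) w = - ceval p w.
Proof. by rewrite /ceval rmorphN hornerN. Qed.

Lemma cevalM p q w : ceval (p * q) w = ceval p w * ceval q w.
Proof. by rewrite /ceval rmorphM hornerM. Qed.

Lemma cevalC a w : ceval a%:P w = a%:C.
Proof. by rewrite /ceval map_polyC hornerC. Qed.

Lemma cevalZ a p w : ceval (a *: p) w = a%:C * ceval p w.
Proof. by rewrite -mul_polyC cevalM cevalC. Qed.

Lemma ceval1 w : ceval 1 w = 1.
Proof. by rewrite /ceval rmorph1 hornerC. Qed.

Lemma cevalXn p n w : ceval (p ^+ n) w = ceval p w ^+ n.
Proof. by rewrite /ceval rmorphXn horner_exp. Qed.

Lemma cevalX w : ceval 'X w = w.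
Proof. by rewrite /ceval map_polyX hornerX. Qed.

Lemma ceval_sum p w : ceval p w = \sum_(k < size p) (p`_k)%:C * w ^+ k.
Proof. by rewrite /ceval /map_poly horner_poly. Qed.

(** Having a polynomial [q] with [p q] uniformly close to [1] on [A] replaces
    both the absence of zeros and the expansion of [1 / p] as a power series. *)
Definition approx_inverse (A : R[i] -> Prop) p := forall eps : R, 0 < eps ->
  exists q, forall w, A w -> normc (1 - ceval p w * ceval q w) <= eps.

Lemma exists_half_expr (eps : R) : 0 < eps -> exists k, 2^-1 ^+ k <= eps.
Proof.
move=> e0; exists (Num.bound eps^-1).
rewrite exprVn -[leRHS]invrK lef_pV2 ?posrE ?exprn_gt0 ?invr_gt0 //.
apply: (le_trans (ltW (archi_boundP _))); first by rewrite invr_ge0 ltW.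
by rewrite -natrX ler_nat ltnW // ltn_expl.
Qed.

(** Neumann series: if [1 - p q] is at most one half, then multiplying [q] by a
    partial geometric sum turns the error into [(1 - p q)^k]. *)
Lemma approx_inverse_half (A : R[i] -> Prop) p q :
  (forall w, A w -> normc (1 - ceval p w * ceval q w) <= 2^-1) -> approx_inverse A p.
Proof.
move=> hq eps /exists_half_expr [k hk].
exists (q * \sum_(i < k) (1 - p * q) ^+ i) => w Aw.
rewrite -cevalM -{1}(ceval1 w) -cevalN -cevalD mulrA.
have -> : 1 - p * q * \sum_(i < k) (1 - p * q) ^+ i = (1 - p * q) ^+ k.
  have := subrX1 (1 - p * q) k.
  move: (\sum_(i < k) _) => S h; rewrite -[RHS](subrK 1) h; ring.
rewrite cevalXn cevalD cevalN ceval1 cevalM normcX; apply: le_trans hk.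
by apply: lerXn2r; rewrite ?nnegrE ?normc_ge0 ?invr_ge0 ?ler0n ?hq.
Qed.

End ComplexPreliminaries.

(** * A Szego recursion for Legendre polynomials *)

Section SzegoRecursion.
Local Open Scope complex_scope.
Local Notation Re := complex.Re.
Local Notation Im := complex.Im.
Variable R : realType.
Implicit Types (x : R) (p q : {poly R}).

Definition circle_pt x : R[i] := x +i* Num.sqrt (1 - x ^+ 2).

Lemma sqr_sqrt_1mx2 x : -1 <= x <= 1 -> Num.sqrt (1 - x ^+ 2) ^+ 2 = 1 - x ^+ 2.
Proof. by move=> hx; rewrite sqr_sqrtr //; nra. Qed.

Lemma circle_pt_unit x : -1 <= x <= 1 -> circle_pt x * conjc (circle_pt x) = 1.
Proof.
move=> /sqr_sqrt_1mx2 hx; apply: complex_eqP; rewrite ?ReM ?ImM /=.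
  by rewrite mulrN opprK -!expr2 hx; ring.
by rewrite mulrN; ring.
Qed.

Lemma normc_circle_pt x : -1 <= x <= 1 -> normc (circle_pt x) = 1.
Proof. by move=> /sqr_sqrt_1mx2 hx; rewrite /normc /= hx addrC subrK sqrtr1. Qed.

(** The function [F_n]: with [x = cos t] it is [L_n + i / (n+1)] times the
    derivative of [L_n (cos t)] with respect to [t]. *)
Definition leg_phase n x : R[i] :=
  (leg R n).[x] +i* - (Num.sqrt (1 - x ^+ 2) * (leg R n)^`().[x] / n.+1%:R).

Definition szego_c n : R := (2 * n + 3)%:R / (2 * n + 4)%:R.
Definition szego_d n : R := (2 * n + 4)%:R^-1.

Lemma Re_conj_circle_leg_phase n x : -1 <= x <= 1 ->
  Re (conjc (circle_pt x) * leg_phase n x) = (leg R n.+1).[x].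
Proof.
move=> /sqr_sqrt_1mx2 hx; rewrite ReM /= mulrNN legE.
rewrite hornerD hornerZ !hornerM hornerX hornerD hornerN hornerXn hornerC.
rewrite !mulrA -expr2 hx; ring.
Qed.

Lemma Im_conj_circle_leg_phase n x : -1 <= x <= 1 ->
  Im (conjc (circle_pt x) * leg_phase n x)
  = - (Num.sqrt (1 - x ^+ 2) * (leg R n.+1)^`().[x] / n.+1%:R).
Proof.
move=> hx; rewrite ImM /= deriv_legS hornerD !hornerM hornerX -polyC_natr hornerC.
have ? : 0 <= n%:R :> R by exact: ler0n.
by field; rewrite gt_eqF //=; lra.
Qed.

(** With [w = zbar F_n], the real part of [F_{n+1}] is that of [w], and its
    imaginary part is that of [w] times [(n+1)/(n+2)]. *)
Lemma leg_phaseS n x : -1 <= x <= 1 ->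
  leg_phase n.+1 x = (szego_c n)%:C * (conjc (circle_pt x) * leg_phase n x)
              + (szego_d n)%:C * (circle_pt x * conjc (leg_phase n x)).
Proof.
move=> hx; have ? : 0 <= n%:R :> R by exact: ler0n.
have -> : circle_pt x * conjc (leg_phase n x) = conjc (conjc (circle_pt x) * leg_phase n x).
  by apply: complex_eqP; rewrite ?(ReJ, ImJ, ReM, ImM) /=; ring.
apply: complex_eqP; rewrite ?ReD ?ImD ?ReCM ?ImCM.
  rewrite ReJ Re_conj_circle_leg_phase // /szego_c /szego_d /=.
  by field; rewrite gt_eqF //=; lra.
rewrite ImJ Im_conj_circle_leg_phase // /szego_c /szego_d /=.
by field; rewrite !gt_eqF //=; lra.
Qed.

(** The two components represent [z^n F_n] and its reversal [z^n Fbar_n]. *)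
Fixpoint szego n : {poly R} * {poly R} :=
  if n is m.+1 then
    let: (g, h) := szego m in
    (szego_c m *: g + szego_d m *: ('X ^+ 2 * h), szego_c m *: ('X ^+ 2 * h) + szego_d m *: g)
  else (1, 1).

Lemma szegoS1 n : (szego n.+1).1
  = szego_c n *: (szego n).1 + szego_d n *: ('X ^+ 2 * (szego n).2).
Proof. by rewrite /=; case: (szego n). Qed.

Lemma szegoS2 n : (szego n.+1).2
  = szego_c n *: ('X ^+ 2 * (szego n).2) + szego_d n *: (szego n).1.
Proof. by rewrite /=; case: (szego n). Qed.

Lemma ceval_szego n x : -1 <= x <= 1 ->
  ceval (szego n).1 (circle_pt x) = circle_pt x ^+ n * leg_phase n x /\
  ceval (szego n).2 (circle_pt x) = circle_pt x ^+ n * conjc (leg_phase n x).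
Proof.
move=> hx; have hz := circle_pt_unit hx; elim: n => [|n [ih1 ih2]].
  rewrite /= !ceval1 expr0 !mul1r.
  by split; apply: complex_eqP; rewrite ?(ReJ, ImJ) /= leg0 ?derivC ?hornerC; ring.
have conjE : conjc (leg_phase n.+1 x) = (szego_c n)%:C * (circle_pt x * conjc (leg_phase n x))
              + (szego_d n)%:C * (conjc (circle_pt x) * leg_phase n x).
  rewrite leg_phaseS //; apply: complex_eqP;
    rewrite ?(ReJ, ImJ, ReD, ImD, ReM, ImM) /=; ring.
rewrite conjE leg_phaseS // szegoS1 szegoS2.
rewrite !cevalD !cevalZ cevalM ih1 ih2 cevalXn cevalX [circle_pt x ^+ n.+1]exprS.
move: (circle_pt x ^+ n) (leg_phase n x) (conjc (leg_phase n x)) => zn f fc.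
move: (conjc (circle_pt x)) hz => zc hz.
have hz2 u : u = circle_pt x * zc * u by rewrite hz mul1r.
split.
  by rewrite [X in (szego_c n)%:C * (zn * X) + _]hz2; ring.
by rewrite [X in _ + (szego_d n)%:C * (zn * X)]hz2; ring.
Qed.

Lemma normc_ceval_szego n x : -1 <= x <= 1 ->
  normc (ceval (szego n).2 (circle_pt x)) = normc (ceval (szego n).1 (circle_pt x)).
Proof. by move=> /(ceval_szego n) [-> ->]; rewrite !normcM normc_conj. Qed.

Definition upper_arc (w : R[i]) := exists2 x, -1 <= x <= 1 & w = circle_pt x.

Lemma szego_step_identity (a d : R) (g h q w : R[i]) : a != 0 ->
  1 - (a%:C * g + d%:C * (w ^+ 2 * h)) * ((a^-1)%:C * q)
  = 1 - g * q - (a^-1 * d)%:C * (w ^+ 2 * (h * q)).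
Proof.
move=> a0; have inv1 : a%:C * (a^-1)%:C = 1 by rewrite -rmorphM mulfV.
rewrite rmorphM -[g * q]mul1r -inv1 /=.
move: (a%:C) ((a^-1)%:C) (d%:C) => u v t; ring.
Qed.

(** On the circle both components of [szego n] have the same modulus, so
    [szego n.+1] is, up to a constant, [szego n] times [1 + r] with
    [|r| <= 1 / (2n+3) <= 1/3].  An approximate inverse of [szego n] with error
    [1/8] is then one of [szego n.+1] with error [1/8 + (1 + 1/8)/3 = 1/2], which
    the Neumann series improves to any precision. *)
Lemma szego_approx_inverse n : approx_inverse upper_arc (szego n).1.
Proof.
elim: n => [|n ih].
  apply: (@approx_inverse_half _ _ _ 1) => w _.
  by rewrite /= ceval1 mulr1 subrr normc0 invr_ge0 ler0n.
have [|q hq] := ih (8^-1); first by rewrite invr_gt0 ltr0n.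
have n0 : 0 <= n%:R :> R by exact: ler0n.
have c0 : szego_c n != 0 by rewrite /szego_c mulf_neq0 ?invr_eq0 ?pnatr_eq0 ?addnS.
apply: (@approx_inverse_half _ _ _ ((szego_c n)^-1 *: q)) => w hw.
have [x hx wE] := hw; have {hq} := hq w hw.
have := normc_ceval_szego n hx; rewrite -wE /=.
case: (szego n) => g h /= hgh hq.
set e := 1 - ceval g w * ceval q w in hq.
have gqE : ceval g w * ceval q w = 1 - e by rewrite /e opprB addrCA subrr addr0.
have hgq : normc (ceval h w * ceval q w) <= 1 + 8^-1.
  rewrite normcM hgh -normcM gqE (le_trans (le_normcD _ _)) // normcN normc1.
  by rewrite lerD2l.
have -> : 1 - ceval (szego_c n *: g + szego_d n *: ('X^2 * h)) w * ceval ((szego_c n)^-1 *: q) w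
  = e - ((szego_c n)^-1 * szego_d n)%:C * (w ^+ 2 * (ceval h w * ceval q w)).
  by rewrite cevalD !cevalZ cevalM cevalXn cevalX szego_step_identity.
rewrite (le_trans (le_normcD _ _)) // normcN normcM normc_real normcM normcX.
rewrite wE normc_circle_pt // -wE expr1n mul1r ger0_norm; last first.
  by rewrite mulr_ge0 ?invr_ge0 ?divr_ge0 ?ler0n.
have k3 : (szego_c n)^-1 * szego_d n <= 3^-1.
  rewrite /szego_c /szego_d invfM invrK mulfK; last by rewrite pnatr_eq0 addnS.
  by rewrite lef_pV2 ?posrE ?ltr0n ?addn3 // ler_nat.
apply: (@le_trans _ _ (8^-1 + 3^-1 * (1 + 8^-1))); last by lra.
apply: lerD => //; apply: ler_pM => //; last exact: normc_ge0.
by rewrite mulr_ge0 ?invr_ge0 ?divr_ge0 ?ler0n.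
Qed.

End SzegoRecursion.

(** * Chebyshev polynomials and approximation *)

Section Chebyshev.
Local Open Scope complex_scope.
Local Notation Re := complex.Re.
Local Notation Im := complex.Im.
Variable R : realType.
Implicit Types (x : R) (p q : {poly R}).

(** The pair [(T_n, U_{n-1})], real part and normalized imaginary part of
    [z^n]. *)
Fixpoint cheb n : {poly R} * {poly R} :=
  if n is m.+1 then
    let: (t, s) := cheb m in ('X * t - (1 - 'X ^+ 2) * s, 'X * s + t)
  else (1, 0).

Definition chebT n := (cheb n).1.
Definition chebS n := (cheb n).2.

Lemma chebTS n : chebT n.+1 = 'X * chebT n - (1 - 'X ^+ 2) * chebS n.
Proof. by rewrite /chebT /chebS /=; case: (cheb n). Qed.

Lemma chebSS n : chebS n.+1 = 'X * chebS n + chebT n.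
Proof. by rewrite /chebT /chebS /=; case: (cheb n). Qed.

(** In terms of [x = cos t] these are the derivatives of [cos (n t)] and
    [sin (n t)]; the second one provides an antiderivative of [T_n] for the
    arcsine weight. *)
Lemma cheb_deriv n : (chebT n)^`() = n%:R * chebS n /\
  (1 - 'X ^+ 2) * (chebS n)^`() = 'X * chebS n - n%:R * chebT n.
Proof.
elim: n => [|n [hT hS]].
  by rewrite /chebT /chebS /= derivC derivC; split; ring.
rewrite chebTS chebSS derivB !derivD !derivM derivX hT derivB derivXn.
rewrite (derivC 1) sub0r -[n.+1]addn1 natrD.
move/eqP: hS; rewrite -subr_eq0 => /eqP.
move: (chebT n) (chebS n) (chebS n)^`() => t s s' hS.
split.
  by rewrite -[LHS]addr0 -[in LHS]hS; ring.
by rewrite -[RHS]addr0 -(mulr0 'X) -[in RHS]hS; ring.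
Qed.

Lemma chebT_three_term n : 2 * 'X * chebT n.+1 = chebT n.+2 + chebT n.
Proof. by rewrite !chebTS chebSS; ring. Qed.

Lemma circle_ptX n x : -1 <= x <= 1 ->
  circle_pt x ^+ n = (chebT n).[x] +i* (Num.sqrt (1 - x ^+ 2) * (chebS n).[x]).
Proof.
move=> /sqr_sqrt_1mx2 hx; elim: n => [|n ih].
  by rewrite /chebT /chebS /= hornerC horner0 mulr0.
rewrite exprS ih chebTS chebSS !hornerD hornerN !hornerM !hornerX hornerD hornerN.
rewrite hornerXn hornerC.
apply: complex_eqP; rewrite ?ReM ?ImM /=; last by ring.
by move: hx; move: (Num.sqrt _) => s <-; ring.
Qed.

Lemma normr_chebT_le1 n x : -1 <= x <= 1 -> `|(chebT n).[x]| <= 1.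
Proof.
move=> hx; have := normr_Re (circle_pt x ^+ n).
by rewrite normcX normc_circle_pt // expr1n circle_ptX.
Qed.

(** The real part of [z^m q(z)] as a polynomial in [x]; the coefficients of [q]
    have to be real for the sines to disappear. *)
Definition cheb_comb m q : {poly R} := \sum_(k < size q) q`_k *: chebT (m + k).

Lemma Re_circle_ptX_ceval m q x : -1 <= x <= 1 ->
  Re (circle_pt x ^+ m * ceval q (circle_pt x)) = (cheb_comb m q).[x].
Proof.
move=> hx; rewrite ceval_sum mulr_sumr /cheb_comb horner_sum.
rewrite (big_morph (@complex.Re R) (@ReD R) (erefl _)).
apply: eq_bigr => k _; rewrite mulrCA -exprD circle_ptX // ReCM /=.
by rewrite hornerZ.
Qed.

Section Functional.
Variable M : {scalar {poly R}}.
Hypothesis M_cheb : forall m, M (chebT m.+1) = 0.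

(** Multiplication by [X] moves a Chebyshev index by one only, so a product of
    [T_m] with a polynomial of degree less than [m] never reaches [T_0]. *)
Lemma chebT_orthogonal m p : (size p <= m)%N -> M (chebT m * p) = 0.
Proof.
apply: (scalar_eq0_basis (B := fun k => 'X^k)) => [j|k]; first by rewrite size_polyXn.
elim: k m => [|k ih] [|m] // hk; first by rewrite mulr1.
case: m hk => // m hk.
have : 2%:R * M (chebT m.+2 * 'X^(k.+1)) = 0.
  have e : 2%:R * (chebT m.+2 * ('X * 'X^k))
      = chebT m.+3 * 'X^k + chebT m.+1 * 'X^k :> {poly R}.
    by rewrite -mulrDl -chebT_three_term; ring.
  by rewrite -scalar_natl exprS e linearD /= !ih ?addr0 // ltnW // ltnW.
by move/eqP; rewrite mulf_eq0 pnatr_eq0 /= => /eqP.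
Qed.

Lemma cheb_comb_orthogonal m q p : (size p <= m)%N -> M (cheb_comb m q * p) = 0.
Proof.
move=> hp; rewrite mulr_suml linear_sum big1 // => k _.
rewrite -scalerAl linearZ /= chebT_orthogonal ?mulr0 //.
exact: leq_trans hp (leq_addr _ _).
Qed.
End Functional.

Definition leg_sum n : {poly R} :=
  \sum_(0 <= k < n.+1) (2 * k + 1)%:R * leg R k ^+ 2.

Lemma leg_sum_horner n x : (leg_sum n).[x]
  = \sum_(0 <= k < n.+1) (2 * k + 1)%:R * (leg R k).[x] ^+ 2.
Proof.
rewrite /leg_sum horner_sum; apply: eq_bigr => k _.
by rewrite hornerM -polyC_natr hornerC horner_exp.
Qed.

Lemma leg_sum_ge1 n x : 1 <= (leg_sum n).[x].
Proof.
rewrite leg_sum_horner big_nat_recl // muln0 add0n leg0 hornerC expr1n mulr1.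
by rewrite lerDl sumr_ge0 // => k _; rewrite mulr_ge0 ?sqr_ge0.
Qed.

Lemma leg_sum_gt0 n x : 0 < (leg_sum n).[x].
Proof. exact: lt_le_trans ltr01 (leg_sum_ge1 n x). Qed.

Lemma leg_phase_sqr n x : -1 <= x <= 1 ->
  Re (leg_phase n x) ^+ 2 + Im (leg_phase n x) ^+ 2 = (leg_sum n).[x] / n.+1%:R ^+ 2.
Proof.
move=> /sqr_sqrt_1mx2 hx; rewrite /leg_sum sum_leg_sqr /=.
rewrite sqrrN exprMn exprMn hx hornerD -polyC_natr !hornerM hornerD hornerN.
rewrite hornerXn !hornerC.
have ? : 0 <= n%:R :> R by exact: ler0n.
by field; rewrite gt_eqF //=; lra.
Qed.

Lemma Re_circle_ptX_div_leg_phase n (e : bool) x : -1 <= x <= 1 ->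
  Re (circle_pt x ^+ e / leg_phase n x)
  = n.+1%:R ^+ 2 * ((leg R (n + e)).[x] / (leg_sum n).[x]).
Proof.
move=> hx; rewrite ReM ReV ImV leg_phase_sqr // invf_div.
transitivity (Re (conjc (circle_pt x ^+ e) * leg_phase n x)
  * (n.+1%:R ^+ 2 / (leg_sum n).[x])).
  by rewrite ReM ReJ ImJ; ring.
rewrite [RHS]mulrCA; congr (_ * _).
case: e; last by rewrite addn0 ReM ReJ ImJ /= oppr0 mul0r mul1r subr0.
by rewrite addn1 expr1 Re_conj_circle_leg_phase.
Qed.

Lemma normc_leg_phase_inv n x : -1 <= x <= 1 -> normc (leg_phase n x)^-1 <= n.+1%:R.
Proof.
move=> hx; rewrite normcV.
have -> : normc (leg_phase n x) = Num.sqrt (Re (leg_phase n x) ^+ 2 + Im (leg_phase n x) ^+ 2).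
  by case: (leg_phase n x).
rewrite leg_phase_sqr // -[leRHS]invrK lef_pV2 ?posrE ?invr_gt0 ?ltr0n //.
  rewrite -[leLHS]ger0_norm ?invr_ge0 // -sqrtr_sqr exprVn ler_wsqrtr //.
  by rewrite ler_peMl ?leg_sum_ge1 // invr_ge0 exprn_ge0.
by rewrite sqrtr_gt0 divr_gt0 ?leg_sum_gt0 ?exprn_gt0.
Qed.

(** The approximate inverse [q] of [z^n F_n] gives [z^e / F_n] as
    [z^(n+e) q(z)] with error [|1 - z^n F_n q| / |F_n|], and
    [1 / |F_n| <= n+1] because [D_n >= 1].  The Boolean [e] treats [L_n] and
    [L_{n+1}] at once. *)
Lemma leg_div_sum_approx n (e : bool) (eps : R) : 0 < eps ->
  exists q, forall x, -1 <= x <= 1 ->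
    `|(leg R (n + e)).[x] / (leg_sum n).[x] - (cheb_comb (n + e) q).[x]| <= eps.
Proof.
move=> eps0.
have d0 : 0 < eps / n.+1%:R by rewrite divr_gt0.
have [q hq] := szego_approx_inverse n d0.
exists ((n.+1%:R ^- 2) *: q) => x hx.
have fz0 : leg_phase n x != 0.
  apply/eqP => f0; have := leg_phase_sqr n hx; rewrite f0 /= expr0n /= addr0.
  by apply/eqP; rewrite eq_sym gt_eqF // divr_gt0 ?leg_sum_gt0 ?exprn_gt0.
have -> : (leg R (n + e)).[x] / (leg_sum n).[x]
    = n.+1%:R ^- 2 * Re (circle_pt x ^+ e / leg_phase n x).
  by rewrite Re_circle_ptX_div_leg_phase // mulKf // expf_neq0 // pnatr_eq0.
rewrite -Re_circle_ptX_ceval // cevalZ mulrCA ReCM -mulrBr.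
rewrite -ReN -ReD normrM.
have -> : circle_pt x ^+ e / leg_phase n x - circle_pt x ^+ (n + e) * ceval q (circle_pt x)
    = circle_pt x ^+ e * (leg_phase n x)^-1
      * (1 - ceval (szego R n).1 (circle_pt x) * ceval q (circle_pt x)).
  rewrite (ceval_szego n hx).1 exprD mulrBr mulr1; congr (_ - _).
  by move: (leg_phase n x) fz0 => f f0; field.
have hb : `|Re (circle_pt x ^+ e / leg_phase n x
     * (1 - ceval (szego R n).1 (circle_pt x) * ceval q (circle_pt x)))| <= eps.
  rewrite (le_trans (normr_Re _)) // !normcM normcX normc_circle_pt // expr1n mul1r.
  rewrite (le_trans (ler_pM _ _ (normc_leg_phase_inv n hx) (hq _ _))) ?normc_ge0 //.
    by exists x.
  by rewrite mulrCA mulfV ?mulr1 // pnatr_eq0.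
rewrite -[leRHS]mul1r ler_pM // ger0_norm ?invr_ge0 ?exprn_ge0 //.
by rewrite invf_le1 ?exprn_gt0 // exprn_ege1 // ler1n.
Qed.

End Chebyshev.

(** * Integration against the arcsine density *)

Section ArcsineIntegral.
Variable R : realType.
Local Notation mu := (@lebesgue_measure R).
Implicit Types (p : {poly R}) (H : R -> R) (x t : R).

Definition arcsine_density x : R := pi^-1 * (Num.sqrt (1 - x ^+ 2))^-1.

Lemma sqrt_1mx2_gt0 x : -1 < x < 1 -> 0 < Num.sqrt (1 - x ^+ 2).
Proof. by move=> hx; rewrite sqrtr_gt0; nra. Qed.

Lemma arcsine_density_continuous x : -1 < x < 1 ->
  {for x, continuous arcsine_density}.
Proof.
move=> hx; apply: cvgM; first exact: cvg_cst.
apply: cvgV; first by rewrite gt_eqF // sqrt_1mx2_gt0.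
apply: continuous_comp; last exact: sqrt_continuous.
by apply: cvgB; [exact: cvg_cst | exact: exprn_continuous].
Qed.

(** The substitution [x = sin t] in differential form. *)
Lemma is_derive_comp_asin p H x :
  (forall t, is_derive t 1 H p.[sin t]) -> -1 < x < 1 ->
  is_derive x 1 (H \o asin) (p.[x] * (Num.sqrt (1 - x ^+ 2))^-1).
Proof.
move=> dH hx; have hd := is_derive1_asin hx.
apply: is_derive_eq (is_derive1_comp (dH (asin x)) hd) _.
by rewrite asinK // in_itv /= !ltW //; case/andP: hx.
Qed.

Lemma arcsine_FTC p H t : (forall t, is_derive t 1 H p.[sin t]) ->
  0 < t < pi / 2 ->
  (\int[mu]_(x in `[(- sin t)%R, sin t]) (p.[x] * arcsine_density x)%:E
   = (pi^-1 * (H t - H (- t)))%:E)%E.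
Proof.
move=> dH ht.
have pi2 : (0 : R) < pi / 2 by have := pi_gt0 R; lra.
have hs0 : 0 < sin t by apply: sin_gt0_pihalf.
have hs1 : sin t < 1.
  by rewrite -(sin_pihalf R) ltr_sin ?in_itv /=; lra.
have hin (x : R) : - sin t <= x <= sin t -> -1 < x < 1 by lra.
have tin : t \in `[(- (pi / 2)), pi / 2] by rewrite in_itv /=; lra.
have Ntin : - t \in `[(- (pi / 2)), pi / 2] by rewrite in_itv /=; lra.
have dF (x : R) : -1 < x < 1 -> is_derive x 1 (fun x => pi^-1 * (H \o asin) x)
    (p.[x] * arcsine_density x).
  move=> hx; have h := is_derive_comp_asin dH hx.
  by apply: is_derive_eq; rewrite /arcsine_density /GRing.scale /=; ring.
have cF (x : R) : -1 < x < 1 -> {for x, continuous (fun x => pi^-1 * (H \o asin) x)}.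
  by move=> /dF [dx _]; apply: differentiable_continuous; exact/derivable1_diffP.
rewrite (@continuous_FTC2 _ _ (fun x => pi^-1 * (H \o asin) x)).
- by rewrite /= -sinN !sinK // -EFinB mulrBr.
- by lra.
- apply: continuous_in_subspaceT => x; rewrite inE /= in_itv /= => /hin hx.
  by apply: cvgM; [exact: continuous_horner | exact: arcsine_density_continuous].
- split.
  + move=> x; rewrite in_itv /= => hx.
    by have [] : is_derive _ _ _ _ := dF x ltac:(apply: hin; lra).
  + by apply: cvg_at_right_filter; apply: cF; lra.
  + by apply: cvg_at_left_filter; apply: cF; lra.
- move=> x; rewrite in_itv /= => hx.
  have h : is_derive _ _ _ _ := dF x ltac:(apply: hin; lra).
  by rewrite derive1E derive_val.
Qed.

(** Angles increasing to [pi / 2]: the sines cut off the endpoints, where the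
    density is unbounded, and the integral over the remaining interval is
    evaluated at the angles themselves, so that continuity of [asin] at the
    endpoints is never involved. *)
Definition angle_cut (i : nat) : R := pi / 2 * (1 - harmonic i / 2).

Lemma angle_cut_itv i : 0 < angle_cut i < pi / 2.
Proof.
have pi2 : (0 : R) < pi / 2 by have := pi_gt0 R; lra.
have h0 : 0 < harmonic i :> R by rewrite /harmonic /= invr_gt0.
have h1 : harmonic i <= 1 :> R by rewrite /harmonic /= invf_le1 // ler1n.
rewrite /angle_cut; move: (harmonic i) h0 h1 => h h0 h1; nra.
Qed.

Lemma angle_cut_cvg : angle_cut i @[i --> \oo] --> pi / 2.
Proof.
have e : pi / 2 = pi / 2 * (1 - 0 / 2) :> R by rewrite mul0r subr0 mulr1.
rewrite [X in _ --> X]e.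
apply: cvgMr; apply: cvgB; first exact: cvg_cst.
by apply: cvgMl; exact: cvg_harmonic.
Qed.

Lemma sin_angle_cut_nondecreasing : nondecreasing_seq (fun i => sin (angle_cut i)).
Proof.
apply/nondecreasing_seqP => i.
have pi2 : (0 : R) < pi / 2 by have := pi_gt0 R; lra.
have h1 := angle_cut_itv i; have h2 := angle_cut_itv i.+1.
rewrite leNgt ltr_sin ?in_itv /= -?leNgt; try lra.
rewrite /angle_cut ler_pM2l // lerD2l lerN2 ler_pM2r ?invr_gt0 //.
by rewrite /harmonic /= lef_pV2 ?posrE // ler_nat.
Qed.

Lemma bigcup_sin_angle_cut :
  \bigcup_i [set` `[- sin (angle_cut i), sin (angle_cut i)]] = [set` `](-1)%R, 1%R[].
Proof.
have pi2 : (0 : R) < pi / 2 by have := pi_gt0 R; lra.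
apply/seteqP; split => x /=.
  move=> [i _] /=; rewrite !in_itv /= => hx.
  have h := angle_cut_itv i.
  have : sin (angle_cut i) < 1 by rewrite -(sin_pihalf R) ltr_sin ?in_itv /=; lra.
  by lra.
rewrite in_itv /= => hx.
have sc : sin (angle_cut i) @[i --> \oo] --> (1 : R).
  rewrite -(sin_pihalf R); apply: continuous_cvg; first exact: continuous_sin.
  exact: angle_cut_cvg.
have x1 : `|x| < 1 by rewrite ltr_norml.
have [i _ hi] := cvgr_gt _ sc _ x1.
exists i => //=; rewrite in_itv /= -ler_norml.
by apply: ltW; apply: hi => /=.
Qed.

(** Nonnegativity allows monotone convergence along the intervals cut off by
    [angle_cut]. *)
Lemma arcsine_integral p H : (forall t, is_derive t 1 H p.[sin t]) ->
  (forall x, -1 <= x <= 1 -> 0 <= p.[x]) ->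
  (\int[mu]_(x in `[(-1)%R, 1%R]) (p.[x] * arcsine_density x)%:E
   = (pi^-1 * (H (pi / 2) - H (- (pi / 2))))%:E)%E.
Proof.
move=> dH p0.
have cH t : {for t, continuous H}.
  by have [dt _] := dH t; apply: differentiable_continuous; exact/derivable1_diffP.
have mf : measurable_fun [set` `](-1)%R, (1%R : R)[] (fun x => p.[x] * arcsine_density x).
  apply: open_continuous_measurable_fun; first exact: interval_open.
  move=> x; rewrite inE /= in_itv /= => hx.
  by apply: cvgM; [exact: continuous_horner | exact: arcsine_density_continuous].
have sub i : [set` `[- sin (angle_cut i), sin (angle_cut i)]] `<=` [set` `](-1)%R, 1%R[].
  by rewrite -bigcup_sin_angle_cut => x hx; exists i.
rewrite integral_itv_bndoo; last exact/measurable_EFinP.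
rewrite -bigcup_sin_angle_cut.
apply: (@cvg_unique _ _ _ _ _ _ (ge0_nondecreasing_set_cvg_integral _ _ _ _)) => //.
- move=> i j ij; apply/subsetPset => x /=; rewrite !in_itv /=.
  by have := sin_angle_cut_nondecreasing ij; lra.
- move=> i; apply/measurable_EFinP; exact: measurable_funS mf.
- move=> i x /sub /=; rewrite in_itv /= => hx; rewrite lee_fin.
  apply: mulr_ge0; first by apply: p0; lra.
  by rewrite mulr_ge0 ?invr_ge0 ?pi_ge0 ?sqrtr_ge0.
rewrite /= (_ : (fun i => _)
  = (fun i => (pi^-1 * (H (angle_cut i) - H (- angle_cut i)))%:E)); last first.
  by apply/funext => i; exact: arcsine_FTC dH (angle_cut_itv i).
apply: cvg_EFin; first by near=> i.
apply: cvgMr; apply: cvgB.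
  by apply: continuous_cvg; [exact: cH | exact: angle_cut_cvg].
by apply: continuous_cvg; [exact: cH | apply: cvgN; exact: angle_cut_cvg].
Unshelve. all: by end_near.
Qed.

End ArcsineIntegral.

(** * The Christoffel functional *)

Section ArcsineFunctional.
Variable R : realType.
Local Notation mu := (@lebesgue_measure R).
Implicit Types (p q : {poly R}) (f g : R -> R) (x t : R).
Local Notation I := ([set` `[(-1)%R, (1%R : R)]]).

Lemma arcsine_density_ge0 x : 0 <= arcsine_density x.
Proof. by rewrite mulr_ge0 ?invr_ge0 ?pi_ge0 ?sqrtr_ge0. Qed.

Lemma pi_inv_length : pi^-1 * (pi / 2 - - (pi / 2)) = 1 :> R.
Proof. by rewrite opprK -splitr mulVf // gt_eqF // pi_gt0. Qed.

Lemma arcsine_density_integral : (\int[mu]_(x in I) (arcsine_density x)%:E = 1)%E.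
Proof.
have dH t : is_derive t 1 (@idfun R) (1 : {poly R}).[sin t].
  by rewrite hornerC; exact: is_derive_id.
rewrite -[RHS](_ : (pi^-1 * (idfun (pi / 2) - idfun (- (pi / 2))))%:E = _).
  rewrite -(arcsine_integral dH) => [|x _]; last by rewrite hornerC.
  by apply: eq_integral => x _; rewrite hornerC mul1r.
by rewrite /= pi_inv_length.
Qed.

Lemma measurable_arcsine_density : measurable_fun I (@arcsine_density R).
Proof.
apply/measurable_fun_itv_bndo_bndcP; apply/measurable_fun_itv_obnd_cbndP.
apply: open_continuous_measurable_fun; first exact: interval_open.
by move=> x; rewrite inE /= in_itv /=; exact: arcsine_density_continuous.
Qed.

Lemma integrable_arcsine_density : mu.-integrable I (EFin \o @arcsine_density R).
Proof.
apply/integrableP; split; first by apply/measurable_EFinP; exact: measurable_arcsine_density.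
rewrite (_ : (\int[mu]_(x in I) _)%E = 1%E) ?ltry //.
rewrite -arcsine_density_integral; apply: eq_integral => x _ /=.
by rewrite ger0_norm // arcsine_density_ge0.
Qed.

Lemma integrable_mul_arcsine f : continuous f ->
  mu.-integrable I (EFin \o (fun x => f x * arcsine_density x)).
Proof.
move=> cf.
have -> : EFin \o (fun x => f x * arcsine_density x)
    = ((EFin \o f) \* (EFin \o @arcsine_density R))%E by [].
apply: integrableMr => //.
- by apply: measurable_funTS; exact: continuous_measurable_fun.
- have := compact_bounded (continuous_compact (continuous_subspaceT cf)
    (@segment_compact _ (-1) 1)).
  by move=> [M [Mr hM]]; exists M; split => // N MN x /= hx; apply: hM => //; exists x.
- exact: integrable_arcsine_density.
Qed.

Definition arcsine_int f : R := \int[mu]_(x in I) (f x * arcsine_density x).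

Lemma EFin_arcsine_int f : continuous f ->
  ((arcsine_int f)%:E = \int[mu]_(x in I) (f x * arcsine_density x)%:E)%E.
Proof.
move=> cf; rewrite /arcsine_int /Rintegral fineK //.
by apply: integrable_fin_num => //; exact: integrable_mul_arcsine.
Qed.

Lemma arcsine_int_linear (a : R) f g : continuous f -> continuous g ->
  arcsine_int (fun x => a * f x + g x) = a * arcsine_int f + arcsine_int g.
Proof.
move=> cf cg; rewrite /arcsine_int.
under eq_Rintegral do rewrite mulrDl -mulrA.
have caf : continuous (fun x => a * f x).
  by move=> x; apply: cvgM; [exact: cvg_cst | exact: cf].
rewrite RintegralD ?RintegralZl //; try exact: integrable_mul_arcsine.
have := integrable_mul_arcsine caf; congr (integrable _ _ _).
by apply/funext => x /=; rewrite mulrA.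
Qed.

Lemma arcsine_int_cst (c : R) : arcsine_int (fun=> c) = c.
Proof.
rewrite /arcsine_int RintegralZl //; last exact: integrable_arcsine_density.
by rewrite /Rintegral arcsine_density_integral mulr1.
Qed.

Lemma normr_arcsine_int_le f (c : R) : continuous f ->
  (forall x, -1 <= x <= 1 -> `|f x| <= c) -> `|arcsine_int f| <= c.
Proof.
move=> cf hf.
rewrite /arcsine_int (le_trans (le_normr_Rintegral _ _)) //.
  exact: integrable_mul_arcsine.
rewrite -[leRHS]arcsine_int_cst; apply: le_Rintegral => //.
- exact: integrable_norm (integrable_mul_arcsine cf).
- by apply: integrable_mul_arcsine => x; exact: cvg_cst.
- move=> x /=; rewrite in_itv /= => hx.
  rewrite normrM [`|arcsine_density x|]ger0_norm ?arcsine_density_ge0 //.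
  by apply: ler_wpM2r; [exact: arcsine_density_ge0 | exact: hf].
Qed.

Definition arcsine_poly p : R := arcsine_int (horner p).

Lemma arcsine_poly_linear : scalar arcsine_poly.
Proof.
move=> a p q; rewrite /arcsine_poly -arcsine_int_linear; try exact: continuous_horner.
by congr arcsine_int; apply/funext => x; rewrite hornerD hornerZ.
Qed.

HB.instance Definition _ :=
  GRing.isLinear.Build R {poly R} R _ arcsine_poly arcsine_poly_linear.

(** [1 + T_n] is nonnegative on the interval, so its integral can be computed
    from an antiderivative in the angle; it comes out equal to that of [1]. *)
Lemma arcsine_poly_chebT n : arcsine_poly (chebT R n.+1) = 0.
Proof.
(* With x = sin t the cosine is sqrt(1 - x^2), so H is the antiderivative
   asin x - sqrt(1 - x^2) U_n(x) / (n+1) of (1 + T_{n+1}) / sqrt(1 - x^2). *)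
pose H t : R := t - n.+1%:R^-1 * (cos t * (chebS R n.+1).[sin t]).
have dH t : is_derive t 1 H (1 + chebT R n.+1).[sin t].
  have [_ dS] := cheb_deriv R n.+1.
  have := congr1 (horner^~ (sin t)) dS.
  rewrite !hornerD !hornerN !hornerM hornerD hornerN hornerXn hornerX -polyC_natr !hornerC.
  rewrite -cos2sin2 => e.
  have dS1 : is_derive t 1 (horner (chebS R n.+1) \o sin)
     (((chebS R n.+1)^`()).[sin t] * cos t).
    exact: is_derive1_comp.
  have dM := is_deriveM (is_derive_cos t) dS1.
  have dZ := is_deriveZ n.+1%:R^-1 dM.
  apply: is_derive_eq (is_deriveB (is_derive_id t 1) dZ) _.
  rewrite /GRing.scale /=.
  have n0 : (n.+1%:R : R) != 0 by rewrite pnatr_eq0.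
  apply: (mulfI n0); rewrite mulrBr mulrA mulfV // mul1r.
  rewrite mulrDr -[n.+1%:R * (chebT _ _).[_]](subKr (sin t * (chebS R n.+1).[sin t])) -e.
  ring.
have p0 x : -1 <= x <= 1 -> 0 <= (1 + chebT R n.+1).[x].
  move=> /(normr_chebT_le1 n.+1); rewrite ler_norml => /andP[h _].
  by rewrite hornerD hornerC; lra.
have : arcsine_poly (1 + chebT R n.+1) = 1.
  rewrite /arcsine_poly /arcsine_int /Rintegral (arcsine_integral dH p0) /= /H.
  rewrite cosN cos_pihalf !mul0r mulr0 !subr0.
  exact: pi_inv_length.
rewrite linearD /= => e.
have e1 : arcsine_poly 1 = 1.
  rewrite -[RHS]arcsine_int_cst /arcsine_poly; congr arcsine_int.
  by apply/funext => x; rewrite hornerC.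
by apply: (addrI (1 : R)); rewrite addr0 -[RHS]e e1.
Qed.

Lemma horner_bounded p :
  exists2 B, 0 < B & forall x, -1 <= x <= 1 -> `|p.[x]| <= B.
Proof.
exists (1 + \sum_(i < size p) `|p`_i|); first by rewrite ltr_pwDl // sumr_ge0.
move=> x hx; rewrite horner_coef (le_trans (ler_norm_sum _ _ _)) //.
rewrite (@le_trans _ _ (\sum_(i < size p) `|p`_i|)) ?lerDr //.
apply: ler_sum => i _; rewrite normrM normrX ler_piMr // exprn_ile1 //.
by rewrite ler_norml.
Qed.

Definition christoffel_int n p : R :=
  arcsine_int (fun x => p.[x] / (leg_sum R n).[x]).

Lemma continuous_div_leg_sum n p : continuous (fun x => p.[x] / (leg_sum R n).[x]).
Proof.
move=> x; apply: cvgM; first exact: continuous_horner.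
by apply: cvgV; [rewrite gt_eqF // leg_sum_gt0 | exact: continuous_horner].
Qed.

Lemma christoffel_int_linear n : scalar (christoffel_int n).
Proof.
move=> a p q; rewrite /christoffel_int -arcsine_int_linear;
  try exact: continuous_div_leg_sum.
by congr arcsine_int; apply/funext => x; rewrite hornerD hornerZ mulrDl mulrA.
Qed.

HB.instance Definition _ n :=
  GRing.isLinear.Build R {poly R} R _ (christoffel_int n) (christoffel_int_linear n).

(** [L_{n+e} / D_n] is a uniform limit of combinations of the [T_m] with
    [m >= n + e], all of which are orthogonal to [p] for the arcsine density. *)
Lemma christoffel_int_leg_low n (e : bool) p : (size p <= n)%N ->
  christoffel_int n (leg R (n + e) * p) = 0.
Proof.
move=> hp; have [B B0 hB] := horner_bounded p.
apply/eqP/negPn/negP; rewrite -normr_gt0 => y0.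
set y := `|_| in y0.
have e0 : 0 < y / 2 / B by rewrite !divr_gt0.
have [q hq] := leg_div_sum_approx n e e0.
suff : y <= y / 2 by lra.
have orth : arcsine_poly (cheb_comb (n + e) q * p) = 0.
  exact: cheb_comb_orthogonal (@arcsine_poly_chebT) _ _ _ (leq_trans hp (leq_addr _ _)).
have cD : continuous (fun x => (-1) * (cheb_comb (n + e) q * p).[x]
    + (leg R (n + e) * p).[x] / (leg_sum R n).[x]).
  move=> x; apply: cvgD; last exact: continuous_div_leg_sum.
  by apply: cvgM; [exact: cvg_cst | exact: continuous_horner].
have := @normr_arcsine_int_le _ (y / 2) cD.
rewrite arcsine_int_linear; [|exact: continuous_horner|exact: continuous_div_leg_sum].
rewrite -/(arcsine_poly _) orth mulr0 add0r; apply => x hx.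
rewrite !hornerM mulN1r addrC mulrAC -mulrBl normrM.
rewrite (le_trans (ler_pM _ _ (hq x hx) (hB x hx))) //.
by rewrite mulfVK ?gt_eqF.
Qed.

(** The common factor left open by [leg_orthogonality] is determined by the
    mass of [D_n], whose integrand is the arcsine density itself. *)
Lemma christoffel_int_leg n i j : (i <= n)%N -> (j <= n)%N ->
  christoffel_int n (leg R i * leg R j)
  = (i == j)%:R / (n.+1%:R * (2 * i + 1)%:R).
Proof.
move=> hi hj.
have orth i' j' : (i' <= n)%N -> (j' <= n)%N ->
    christoffel_int n (leg R i' * leg R j')
    = (i' == j')%:R * christoffel_int n 1 / (2 * i' + 1)%:R.
  apply: leg_orthogonality => p hp /=.
    by have := christoffel_int_leg_low false hp; rewrite addn0.
  by have := christoffel_int_leg_low true hp; rewrite addn1.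
have mass : christoffel_int n (leg_sum R n) = 1.
  rewrite -[RHS]arcsine_int_cst /christoffel_int; congr arcsine_int.
  by apply/funext => x; rewrite mulfV // gt_eqF // leg_sum_gt0.
have mass1 : christoffel_int n 1 = n.+1%:R^-1.
  move: mass; rewrite /leg_sum linear_sum /=.
  under eq_big_nat => k /andP[_ hk].
    rewrite (scalar_natl (christoffel_int n)) expr2 /= orth // eqxx mul1r.
    rewrite mulrCA mulfV ?mulr1 ?pnatr_eq0 ?addn1 //. over.
  rewrite sumr_const_nat subn0 => h.
  by apply: (mulfI (x := (n.+1%:R : R))); rewrite ?pnatr_eq0 // mulfV ?pnatr_eq0 // mulr_natl.
by rewrite orth // mass1 -mulrA -invfM.
Qed.

End ArcsineFunctional.

Theorem theorem1 (R : realType) (P : nat -> {poly R}) (hP : is_legendre P)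
    (n i j : nat) (hi : (i <= n)%N) (hj : (j <= n)%N) :
  (\int[@lebesgue_measure R]_(x in `[(-1)%R, 1%R])
     (legendre_star P i x * legendre_star P j x * (christoffel P n x)^-1
        * pi^-1 * (Num.sqrt (1 - x ^+ 2))^-1)%:E
   = ((i == j)%:R : R)%:E)%E.
Proof.
rewrite (is_legendre_unique hP).
have s2 : Num.sqrt 2 ^+ 2 = 2 :> R by rewrite sqr_sqrtr.
have s20 : Num.sqrt 2 != 0 :> R by rewrite gt_eqF // sqrtr_gt0.
have KE x : christoffel (leg R) n x = (leg_sum R n).[x] / (2 * n.+1%:R).
  rewrite /christoffel leg_sum_horner invfM mulrC mulr_suml mulr_suml.
  apply: eq_bigr => k _; rewrite /legendre_star exprMn expr_div_n s2.
  by rewrite sqr_sqrtr //; ring.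
pose c : R := n.+1%:R * (Num.sqrt (2 * i + 1)%:R * Num.sqrt (2 * j + 1)%:R).
(* The summand 0 gives f the shape of a linear combination of two functions. *)
pose f x := c * ((leg R i * leg R j).[x] / (leg_sum R n).[x]) + 0.
have cf : continuous f.
  move=> x; apply: cvgD; last exact: cvg_cst.
  by apply: cvgM; [exact: cvg_cst | exact: continuous_div_leg_sum].
transitivity (\int[@lebesgue_measure R]_(x in `[(-1)%R, 1%R])
    (f x * arcsine_density x)%:E)%E.
  apply: eq_integral => x _; congr EFin.
  rewrite KE /legendre_star /f /c /arcsine_density hornerM addr0 invf_div.
  rewrite -[X in X * n.+1%:R / _]s2.
  have L0 : (leg_sum R n).[x] != 0 by rewrite gt_eqF // leg_sum_gt0.
  move: (pi^-1) ((Num.sqrt (1 - x ^+ 2))^-1) (leg_sum R n).[x] L0 => u v L L0.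
  move: (Num.sqrt 2) s20 => r r0.
  by field; rewrite r0 L0.
rewrite -(EFin_arcsine_int cf) /f.
rewrite arcsine_int_linear; [|exact: continuous_div_leg_sum|by move=> x; exact: cvg_cst].
rewrite arcsine_int_cst addr0 -/(christoffel_int n _) christoffel_int_leg // /c.
congr EFin; have [<-|] := eqVneq i j; last by rewrite mul0r mulr0.
by rewrite -expr2 sqr_sqrtr // mul1r mulfV // mulf_neq0 // pnatr_eq0 // addn1.
Qed.
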